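(* Assume the setting, data and notation fixed in the context; in particular $\mathcal{A}\subset\mathbb{R}^{N_v}$ and $\mathcal{B}\subset\mathbb{R}^{N_w}$ are the sets of admissible control and disturbance parameters, $\mathcal{B}\neq\emptyset$, $J_h$ is the semi-discretized parametrized cost, $\widetilde N = N_v+1$, $Z_F$ is the (nonempty) set of feasible initial states, and $V^{*}$ and $G$ are the optimal value functions of the semi-infinite program and of its finite relaxation. Suppose that the following Slater-type condition holds, for a set $\mathbb{V}'\subset \operatorname{int}\mathbb{V}$: for every $\widetilde N$-tuple $(t^i,\beta^i)_{i=1}^{\widetilde N}\in([0,T]\times\mathcal{B})^{\widetilde N}$ (and the given initial state $\bar z$) there is $(s,\alpha)\in\mathbb{R}\times\mathbb{R}^{N_v}$ such that, for every $i\in\{1,\dots,\widetilde N\}$, $$J_h(\bar z,\alpha,\beta^i)<s,\quad \langle\alpha,\Psi(0)\rangle=v_0,\quad \langle\alpha,\Psi(0)\rangle+\langle\beta^i,\Phi(0)\rangle=\bar y(1),\quad \langle\alpha,\Psi(t^i)\rangle+\langle\beta^i,\Phi(t^i)\rangle\in\mathbb{V}'.$$ Let $\mathcal{U}:=[0,T]^{\widetilde N}\times\mathcal{B}^{\widetilde N}$. For $\bar z\in Z_F$ consider the global maximization problem $$\sup_{(\mathbf t,\mathbf b)\in\mathcal{U}} G(\mathbf t,\mathbf b;\bar z).\qquad(\ast)$$ Then: (a) (regularity) for every $\bar z\in Z_F$, the map $\mathcal{U}\ni(\mathbf t,\mathbf b)\mapsto G(\mathbf t,\mathbf b;\bar z)\in\mathbb{R}$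 is Lipschitz continuous; (b) (existence) for every $\bar z\in Z_F$ there exists $(\mathbf t^*(\bar z),\mathbf b^*(\bar z))\in\mathcal{U}$ that solves $(\ast)$; (c) (exact solutions) $V^{*}(\bar z)=G(\mathbf t^*(\bar z),\mathbf b^*(\bar z);\bar z)$ for every $\bar z\in Z_F$.
   Context: Hölder norm. Fix $\rho\in(0,1]$ and $T>0$. $\mathcal{R}:=\mathcal{C}^{3,\rho}([0,T];\mathbb{R})$ is the space of $\mathcal{C}^3$ functions $f$ on $[0,T]$ whose third derivative is $\rho$-Hölder, with norm $\|f\|_{\mathcal{R}}=\sum_{j=0}^{3}\|f^{(j)}\|_\infty+\sup_{s\ne t}\frac{|f^{(3)}(t)-f^{(3)}(s)|}{|t-s|^{\rho}}$. Data. The underlying system is the heat equation $y_t=y_{xx}$ on $(0,1)$, with $y(0,t)=0$, $y(1,t)=v(t)+w(t)$ ($v$ control, $w$ disturbance) and initial profile $\bar y$ continuous with $\bar y(0)=0$. $\mathbb{V},\mathbb{W}\subset\mathbb{R}$ are compact intervals containing $0$ in their interiors; $v_0\in\mathbb{V}$ with $\bar y(1)-v_0\in\mathbb{W}$; $M_v,M_w>0$ are norm bounds; $\lambda,\gamma>0$. Semi-discretization. Fix $n\in\mathbb{N}\cup\{0\}$ and $h=1/(n+1)$. A finite difference discretization in space gives the linear system $\dot z(t)=A_nz(t)+B_n(v(t)+w(t))$, $z(0)=\bar z$, with $A_n\in\mathbb{R}^{n\times n}$, $B_n\in\mathbb{R}^{n\times1}$ fixed matrices determined by the finite difference scheme (regarded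 as given), initial state $\bar z\in\mathbb{R}^n$, and fixed target state $z_\Omega\in\mathbb{R}^n$ (the sampled target profile). Parametrization. $\{\psi_i\}$ and $\{\phi_i\}$ are dictionaries of bounded, linearly independent functions in $\mathcal{C}^{3,\rho}([0,T];\mathbb{R})$. Fix $N_v,N_w\in\mathbb{N}$ and put $\Psi(t)=(\psi_1(t),\dots,\psi_{N_v}(t))$, $\Phi(t)=(\phi_1(t),\dots,\phi_{N_w}(t))$. Controls and disturbances are $v(t)=\langle\alpha,\Psi(t)\rangle$, $w(t)=\langle\beta,\Phi(t)\rangle$, with $\alpha\in\mathbb{R}^{N_v}$, $\beta\in\mathbb{R}^{N_w}$. Cost. $$J_h(\bar z,\alpha,\beta)=\frac h2\Big\|e^{A_nT}\bar z+\int_0^Te^{A_n(T-\tau)}B_n\big(\langle\alpha,\Psi(\tau)\rangle+\langle\beta,\Phi(\tau)\rangle\big)d\tau-z_\Omega\Big\|^2+\frac\lambda2\int_0^T\langle\alpha,\Psi(t)\rangle^2dt-\frac\gamma2\int_0^T\langle\beta,\Phi(t)\rangle^2dt.$$ Admissible parameters. $$\mathcal{B}=\{\beta\in\mathbb{R}^{N_w}: v_0+\langle\beta,\Phi(0)\rangle=\bar y(1),\ \|\langle\beta,\Phi(\cdot)\rangle\|_{\mathcal{R}}\le M_w,\ \langle\beta,\Phi(t)\rangle\in\mathbb{W}\ \forall t\in[0,T]\},$$ $$\mathcal{A}=\{\alpha\in\mathbb{R}^{N_v}:\langle\alpha,\Psi(0)\rangle=v_0,\ \|\langle\alpha,\Psi(\cdot)\rangle\|_{\mathcal{R}}\le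 M_v,\ \langle\alpha,\Psi(t)\rangle+\langle\beta,\Phi(t)\rangle\in\mathbb{V}\ \forall t\in[0,T],\ \forall\beta\in\mathcal{B}\}.$$ It is assumed that $\mathcal{B}\ne\emptyset$. Semi-infinite program (SIP). For $\bar z\in\mathbb{R}^n$: minimize $s$ over $(s,\alpha)\in\mathbb{R}\times\mathcal{A}$ subject to $J_h(\bar z,\alpha,\beta)\le s$, $\langle\alpha,\Psi(0)\rangle=v_0$, $\langle\alpha,\Psi(0)\rangle+\langle\beta,\Phi(0)\rangle=\bar y(1)$ and $\langle\alpha,\Psi(t)\rangle+\langle\beta,\Phi(t)\rangle\in\mathbb{V}$ for all $t\in[0,T]$ and all $\beta\in\mathcal{B}$. $Z_F$ denotes the set of initial states $\bar z\in\mathbb{R}^n$ for which the SIP is feasible (assumed nonempty), and $V^{*}(\bar z)$ is the optimal value of the SIP for $\bar z\in Z_F$. Finite relaxation. With $\widetilde N:=N_v+1$, for $\mathbf t=(t^1,\dots,t^{\widetilde N})\in[0,T]^{\widetilde N}$ and $\mathbf b=(\beta^1,\dots,\beta^{\widetilde N})\in\mathcal{B}^{\widetilde N}$, $G(\mathbf t,\mathbf b;\bar z)$ is the infimum of $s$ over $(s,\alpha)\in\mathbb{R}\times\mathcal{A}$ subject to $J_h(\bar z,\alpha,\beta^i)\le s$, $\langle\alpha,\Psi(0)\rangle=v_0$, $\langle\alpha,\Psi(t^i)\rangle+\langle\beta^i,\Phi(t^i)\rangle\in\mathbb{V}$ for each $i\in\{1,\dots,\widetilde N\}$. *)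

(* Defs.v *)
From HB Require Import structures.
From mathcomp Require Import all_boot all_order all_algebra.
From mathcomp Require Import all_classical all_reals all_analysis.

Set Implicit Arguments.
Unset Strict Implicit.
Unset Printing Implicit Defensive.

Import Order.TTheory GRing.Theory Num.Theory.
Import numFieldNormedType.Exports.

Local Open Scope classical_set_scope.
Local Open Scope ring_scope.

(* A function on [0, T] is represented by a total f : R -> R of which only the
   values on [0, T] matter: the difference quotients are restricted to [0, T],
   so the derivatives at 0 and T are the one-sided ones. *)
Definition quotients (R : realType) (T : R) (f : R -> R) (x : R) :
    set_system R :=
  (fun y => (f y - f x) / (y - x)) @ within `[0, T] x^'.

Definition derivable_on (R : realType) (T : R) (f : R -> R) : Prop :=
  forall x, x \in `[0, T] -> cvg (quotients T f x).

Definition deriv_on (R : realType) (T : R) (f : R -> R) (x : R) : R :=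
  lim (quotients T f x).

Definition derivn_on (R : realType) (T : R) (j : nat) (f : R -> R) : R -> R :=
  iter j (deriv_on T) f.

Definition sup_norm (R : realType) (T : R) (f : R -> R) : \bar R :=
  ereal_sup [set `|f t|%:E | t in `[0, T]].

Definition holder_seminorm (R : realType) (rho T : R) (f : R -> R) : \bar R :=
  ereal_sup [set (`|f st.1 - f st.2| / `|st.1 - st.2| `^ rho)%:E
            | st in [set st : R * R |
                [/\ st.1 \in `[0, T], st.2 \in `[0, T] & st.1 != st.2]]].

Definition C3rho (R : realType) (rho T : R) (f : R -> R) : Prop :=
  [/\ forall j, (j < 3)%N -> derivable_on T (derivn_on T j f),
      {within `[0, T], continuous (derivn_on T 3 f)} &
      (holder_seminorm rho T (derivn_on T 3 f) < +oo)%E].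

Definition C3rho_norm (R : realType) (rho T : R) (f : R -> R) : \bar R :=
  (\sum_(j < 4) sup_norm T (derivn_on T j f)
   + holder_seminorm rho T (derivn_on T 3 f))%E.

Definition lin_indep (R : realType) (T : R) (N : nat) (F : 'I_N -> R -> R) :
    Prop :=
  forall c : 'rV[R]_N,
    (forall t, t \in `[0, T] -> \sum_(i < N) c 0 i * F i t = 0) -> c = 0.

(* The entrywise sum of the exponential series. *)
Definition expmx (R : realType) (n : nat) (A : 'M[R]_n) : 'M[R]_n :=
  \matrix_(i, j)
    limn (fun N : nat => \sum_(k < N) (k`!%:R)^-1 * (A ^+ k) i j).

Definition l2norm (R : realType) (n : nat) (x : 'cV[R]_n) : R :=
  Num.sqrt (\sum_(i < n) x i 0 ^+ 2).

(* Of the dictionaries only the elements that enter Psi and Phi are kept, and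
   the matrices of the finite difference scheme are arbitrary. *)
Record sip_data (R : realType) := SipData {
  rho : R;
  Tf : R; (* the horizon T *)
  ybar : R -> R;
  VV : set R;
  WW : set R;
  v0 : R;
  Mv : R;
  Mw : R;
  lambda : R;
  gamma : R;
  zdim : nat; (* n; the mesh size is h = 1 / (n + 1) *)
  An : 'M[R]_zdim;
  Bn : 'cV[R]_zdim;
  zOmega : 'cV[R]_zdim;
  Nv : nat;
  Nw : nat;
  psi : 'I_Nv -> R -> R;
  phi : 'I_Nw -> R -> R
}.

Arguments psi {R} s _ _.
Arguments phi {R} s _ _.
Unset Implicit Arguments.

Record standing {R : realType} (P : sip_data R) : Prop := Standing {
  rho_gt0 : 0 < rho P;
  rho_le1 : rho P <= 1;
  T_gt0 : 0 < Tf P;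
  ybar_cont : {within `[0, 1], continuous (ybar P)};
  ybar0 : ybar P 0 = 0;
  VV_itv : is_interval (VV P);
  VV_compact : compact (VV P);
  VV_0 : (VV P)° 0;
  WW_itv : is_interval (WW P);
  WW_compact : compact (WW P);
  WW_0 : (WW P)° 0;
  VV_v0 : VV P (v0 P);
  WW_w0 : WW P (ybar P 1 - v0 P);
  Mv_gt0 : 0 < Mv P;
  Mw_gt0 : 0 < Mw P;
  lambda_gt0 : 0 < lambda P;
  gamma_gt0 : 0 < gamma P;
  Nv_gt0 : (0 < Nv P)%N;
  Nw_gt0 : (0 < Nw P)%N;
  psi_C3rho : forall i, C3rho (rho P) (Tf P) (psi P i);
  phi_C3rho : forall i, C3rho (rho P) (Tf P) (phi P i);
  psi_bounded : forall i, [bounded psi P i t | t in `[0, Tf P]];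
  phi_bounded : forall i, [bounded phi P i t | t in `[0, Tf P]];
  psi_indep : lin_indep (Tf P) (psi P);
  phi_indep : lin_indep (Tf P) (phi P)
}.

Definition control {R : realType} (P : sip_data R) (alpha : 'rV[R]_(Nv P))
    (t : R) : R :=
  \sum_(i < Nv P) alpha 0 i * psi P i t.

Definition disturbance {R : realType} (P : sip_data R) (beta : 'rV[R]_(Nw P))
    (t : R) : R :=
  \sum_(i < Nw P) beta 0 i * phi P i t.

(* z(T), by the variation of constants formula; the integral is entrywise. *)
Definition final_state {R : realType} (P : sip_data R) (zbar : 'cV[R]_(zdim P))
    (alpha : 'rV[R]_(Nv P)) (beta : 'rV[R]_(Nw P)) : 'cV[R]_(zdim P) :=
  expmx (Tf P *: An P) *m zbar
  + \col_i \int[lebesgue_measure]_(tau in `[0, Tf P])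
      ((expmx ((Tf P - tau) *: An P) *m Bn P) i 0
       * (control P alpha tau + disturbance P beta tau)).

Definition cost {R : realType} (P : sip_data R) (zbar : 'cV[R]_(zdim P))
    (alpha : 'rV[R]_(Nv P)) (beta : 'rV[R]_(Nw P)) : R :=
  (zdim P).+1%:R^-1 / 2 * l2norm (final_state P zbar alpha beta - zOmega P) ^+ 2
  + lambda P / 2
    * \int[lebesgue_measure]_(t in `[0, Tf P]) (control P alpha t ^+ 2)
  - gamma P / 2
    * \int[lebesgue_measure]_(t in `[0, Tf P]) (disturbance P beta t ^+ 2).

Definition admB {R : realType} (P : sip_data R) : set 'rV[R]_(Nw P) :=
  [set beta | [/\ v0 P + disturbance P beta 0 = ybar P 1,
    (C3rho_norm (rho P) (Tf P) (disturbance P beta) <= (Mw P)%:E)%E &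
    forall t : R, t \in `[0, Tf P] -> WW P (disturbance P beta t)]].

Definition admA {R : realType} (P : sip_data R) : set 'rV[R]_(Nv P) :=
  [set alpha | [/\ control P alpha 0 = v0 P,
    (C3rho_norm (rho P) (Tf P) (control P alpha) <= (Mv P)%:E)%E &
    forall (t : R) (beta : 'rV[R]_(Nw P)), t \in `[0, Tf P] -> admB P beta ->
      VV P (control P alpha t + disturbance P beta t)]].

Definition sip_feasible {R : realType} (P : sip_data R)
    (zbar : 'cV[R]_(zdim P)) :
    set (R * 'rV[R]_(Nv P)) :=
  [set sa | admA P sa.2 /\
    forall (t : R) (beta : 'rV[R]_(Nw P)), t \in `[0, Tf P] -> admB P beta ->
      [/\ cost P zbar sa.2 beta <= sa.1,
          control P sa.2 0 = v0 P,
          control P sa.2 0 + disturbance P beta 0 = ybar P 1 &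
          VV P (control P sa.2 t + disturbance P beta t)]].

Definition ZF {R : realType} (P : sip_data R) : set 'cV[R]_(zdim P) :=
  [set zbar | sip_feasible P zbar !=set0].

(* Infima are taken in \bar R, so that their finiteness is not built in. *)
Definition Vstar {R : realType} (P : sip_data R) (zbar : 'cV[R]_(zdim P)) :
    \bar R :=
  ereal_inf [set sa.1%:E | sa in sip_feasible P zbar].

(* A tuple (t, b) is a row of times and a matrix whose i-th row is beta^i; this
   product of matrix spaces carries the library's maximum norm. *)
Definition UU {R : realType} (P : sip_data R) :
    set ('rV[R]_(Nv P).+1 * 'M[R]_((Nv P).+1, Nw P)) :=
  [set u : 'rV[R]_(Nv P).+1 * 'M[R]_((Nv P).+1, Nw P) |
    forall i, u.1 0 i \in `[0, Tf P] /\ admB P (row i u.2)].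

Definition relax_feasible {R : realType} (P : sip_data R)
    (zbar : 'cV[R]_(zdim P))
    (u : 'rV[R]_(Nv P).+1 * 'M[R]_((Nv P).+1, Nw P)) :
    set (R * 'rV[R]_(Nv P)) :=
  [set sa | admA P sa.2 /\
    forall i, [/\ cost P zbar sa.2 (row i u.2) <= sa.1,
      control P sa.2 0 = v0 P &
      VV P (control P sa.2 (u.1 0 i) + disturbance P (row i u.2) (u.1 0 i))]].

Definition G {R : realType} (P : sip_data R) (zbar : 'cV[R]_(zdim P))
    (u : 'rV[R]_(Nv P).+1 * 'M[R]_((Nv P).+1, Nw P)) : \bar R :=
  ereal_inf [set sa.1%:E | sa in relax_feasible P zbar u].

(* alpha is not required to be admissible here. *)
Definition slater {R : realType} (P : sip_data R) (VV' : set R)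
    (zbar : 'cV[R]_(zdim P)) : Prop :=
  forall u : 'rV[R]_(Nv P).+1 * 'M[R]_((Nv P).+1, Nw P),
    UU P u -> exists (s : R) (alpha : 'rV[R]_(Nv P)),
    forall i, [/\ cost P zbar alpha (row i u.2) < s,
      control P alpha 0 = v0 P,
      control P alpha 0 + disturbance P (row i u.2) 0 = ybar P 1 &
      VV' (control P alpha (u.1 0 i) + disturbance P (row i u.2) (u.1 0 i))].

Definition solves_max {R : realType} (P : sip_data R) (zbar : 'cV[R]_(zdim P))
    (u : 'rV[R]_(Nv P).+1 * 'M[R]_((Nv P).+1, Nw P)) : Prop :=
  UU P u /\ G P zbar u = ereal_sup [set G P zbar u' | u' in UU P].

(* Main.v *)
Require Import Defs.
From HB Require Import structures.
From mathcomp Require Import all_boot all_order all_algebra.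
From mathcomp Require Import all_classical all_reals all_analysis.
From mathcomp Require Import ring lra.

Import Order.TTheory GRing.Theory Num.Theory.
Import numFieldNormedType.Exports.

Local Open Scope classical_set_scope.
Local Open Scope ring_scope.

(** An admissible control parameter satisfies the state constraint for all times
    and all admissible disturbances, and its initial value is prescribed, so on
    [UU] the relaxed problem at a tuple of disturbances [b_1, ..., b_n], with
    [n = Nv + 1], is the minimization over [admA] of the maximum of the
    [cost a b_i], while the semi-infinite program minimizes over [admA] the
    supremum of [cost a b] over [b] in [admB].

    The cost is a polynomial of degree two in [(a, b)], convex in [a]: the final
    state is affine in the parameters ([final_state_affine], where the integrals
    make sense because the entries of the matrix exponential are continuous),
    and the concave disturbance term does not involve [a]. The sets [admA] and
    [admB] are closed, since a bound on the Hoelder norm is a family of bounds on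
    absolute values of linear functionals of the coefficients
    ([C3rho_norm_le]), and [admA] is convex for the same reason. They are bounded
    because a linear combination of linearly independent functions controls its
    coefficients ([lin_indep_bounded]).

    Regularity: [cost] is bounded and Lipschitz continuous in [b] on
    [admA * admB], uniformly in [a] ([cost_unif_lip]), and this passes to minima
    of maxima ([G_lip]). Existence: a continuous function attains its maximum on
    a compact set ([exists_max]).

    Exactness: let [r] be the maximum of [G] and [e > 0]. The sets of the [a] in
    [admA] with [cost a b <= r + e] are compact and convex in dimension [Nv], and
    by the choice of [r] any [Nv + 1] of them have a common point. By Helly's
    theorem ([helly_compact]) all of them have one ([uniform_level]), so the
    optimal value of the semi-infinite program is at most [r + e]. The reverse
    inequality holds as the relaxation has fewer constraints. *)


(** * Helly's theorem *)

Definition convexs {R : realType} {V : lmodType R} (C : set V) : Prop :=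
  forall x y (t : R), C x -> C y -> 0 <= t <= 1 -> C (t *: x + (1 - t) *: y).

(** The weights are normalized here because the sign splitting in Radon's
    argument produces positive weights of arbitrary sum. *)
Lemma convexs_comb {R : realType} {V : lmodType R} (C : set V) (I : finType)
    (P : pred I) (a : I -> R) (x : I -> V) :
  convexs C -> (forall i, P i -> 0 <= a i) -> (forall i, P i -> C (x i)) ->
  0 < \sum_(i | P i) a i ->
  C ((\sum_(i | P i) a i)^-1 *: \sum_(i | P i) a i *: x i).
Proof.
move=> cC a0 Cx.
(* A sublist of total weight zero has no normalized combination; its weighted
   sum is then zero. *)
suff: 0 <= \sum_(i | P i) a i /\
    (if \sum_(i | P i) a i == 0 then \sum_(i | P i) a i *: x i = 0
     else C ((\sum_(i | P i) a i)^-1 *: \sum_(i | P i) a i *: x i)).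
  by move=> [_]; case: eqP => // ->; rewrite ltxx.
elim: (index_enum I) => [|i s [S0 IH]]; first by rewrite !big_nil eqxx.
rewrite !big_cons; case: ifP => // Pi.
have ai0 := a0 _ Pi; split; first exact: addr_ge0.
move: S0 IH.
set S := \sum_(j <- s | P j) a j; set X := \sum_(j <- s | P j) a j *: x j => S0.
case: eqP => [-> -> | /eqP Sn0 CX].
  rewrite !addr0; case: eqP => [->|/eqP ai]; first by rewrite scale0r.
  by rewrite scalerA mulVf // scale1r; exact: Cx.
have Sgt0 : 0 < S by rewrite lt_neqAle eq_sym Sn0.
have aS : 0 < a i + S by rewrite ltr_wpDl.
rewrite gt_eqF //.
have := cC _ _ (a i / (a i + S)) (Cx _ Pi) CX.
rewrite divr_ge0 ?(ltW aS) //= ler_pdivrMr // mul1r lerDl S0 => /(_ isT).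
rewrite scalerDr !scalerA mulrC; congr (C (_ + _ *: _)).
by field; rewrite (gt_eqF Sgt0) gt_eqF.
Qed.

(** The [n] rows [(x_i, 1)] live in dimension [d + 1 < n], so they are linearly
    dependent. *)
Lemma affine_dependence {R : realType} {d n : nat} (x : 'I_n -> 'rV[R]_d) :
  (d.+1 < n)%N ->
  exists c : 'rV[R]_n,
    [/\ c != 0, \sum_i c 0 i = 0 & \sum_i c 0 i *: x i = 0].
Proof.
move=> dn; pose M : 'M[R]_(n, d + 1) := row_mx (\matrix_i x i) (const_mx 1).
have kM : kermx M != 0.
  rewrite kermx_eq0 /row_free; apply: contraTneq dn => rM.
  by rewrite -leqNgt -addn1 -{1}rM rank_leq_col.
exists (nz_row (kermx M)); have : nz_row (kermx M) *m M = 0.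
  by apply/sub_kermxP; exact: nz_row_sub.
set c := nz_row _; rewrite mul_mx_row -[RHS]row_mx0 => /eq_row_mx[cx c1].
split; first by rewrite /c nz_row_eq0.
- move/matrixP : c1 => /(_ 0 0); rewrite [LHS]mxE [RHS]mxE => e; rewrite -[RHS]e.
  by apply: eq_bigr => i _; rewrite !mxE mulr1.
- rewrite -[RHS]cx mulmx_sum_row.
  by apply: eq_bigr => i _; rewrite rowK.
Qed.

(** Radon's argument for the induction on the number of sets: as [x i] lies in all
    sets but possibly the [i]th, split an affine dependence of the [x i] by the sign of
    its coefficients; the common point of the two convex hulls lies in every
    set. *)
Lemma radon_step {R : realType} {d n : nat} (C : 'I_n -> set 'rV[R]_d)
    (x : 'I_n -> 'rV[R]_d) :
  (d.+1 < n)%N -> (forall i, convexs (C i)) ->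
  (forall i j, i != j -> C i (x j)) ->
  exists y, forall i, C i y.
Proof.
move=> dn cC Cx; have [c [c0 sc scx]] := affine_dependence x dn.
pose P i := 0 < c 0 i.
have eS : \sum_(i | P i) c 0 i = \sum_(i | ~~ P i) - c 0 i.
  by move: sc; rewrite (bigID P) /= sumrN => /eqP; rewrite addr_eq0 => /eqP.
have eX : \sum_(i | P i) c 0 i *: x i = \sum_(i | ~~ P i) - c 0 i *: x i.
  move: scx; rewrite (bigID P) /= => /eqP; rewrite addr_eq0 => /eqP ->.
  by rewrite -sumrN; apply: eq_bigr => i _; rewrite scaleNr.
have Sgt0 : 0 < \sum_(i | P i) c 0 i.
  have S0 : 0 <= \sum_(i | P i) c 0 i by apply: sumr_ge0 => i /ltW.
  rewrite lt_neqAle S0 andbT; apply: contra c0 => /eqP/esym S0'.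
  apply/eqP/rowP => i; rewrite mxE; have [Pi|nPi] := boolP (P i).
    by apply: (psumr_eq0P _ S0') => // j /ltW.
  apply/eqP; rewrite -oppr_eq0; apply/eqP.
  by move: S0'; rewrite eS => /psumr_eq0P; apply=> // j; rewrite oppr_ge0 leNgt.
exists ((\sum_(i | P i) c 0 i)^-1 *: \sum_(i | P i) c 0 i *: x i) => i.
have [Pi|nPi] := boolP (P i); last first.
  apply: convexs_comb => // j Pj; first exact: ltW.
  by apply: Cx; apply: contraNneq nPi => ->.
rewrite eX eS; apply: convexs_comb => //; last by rewrite -eS.
- by move=> j; rewrite oppr_ge0 leNgt.
- by move=> j nPj; apply: Cx; apply: contraNneq nPj => <-.
Qed.

(** Families are sampled by maps [g], possibly with repetitions, so that the
    hypothesis also covers fewer than [d + 1] sets. *)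
Lemma helly_finite {R : realType} {d : nat} {I : Type} (C : I -> set 'rV[R]_d) :
  (forall i, convexs (C i)) ->
  (forall g : 'I_d.+1 -> I, exists y, forall k, C (g k) y) ->
  forall n (g : 'I_n -> I), exists y, forall k, C (g k) y.
Proof.
move=> cC hC; elim=> [|n IH] g; first by exists 0 => -[].
have [nd|dn] := leqP n d.
  have [y Cy] := hC (fun k => g (inord k)).
  exists y => k; rewrite -[k]inord_val -(@inordK d k) //.
  by rewrite (leq_trans (ltn_ord k)).
have {IH}/choice[x Cx] : forall j : 'I_n.+1,
    exists y, forall k : 'I_n, C (g (lift j k)) y by move=> j; exact: IH.
apply: (radon_step (C \o g) x) => //= i j ij.
by case: (unliftP j i) ij => [k -> _|->]; [exact: Cx|rewrite eqxx].
Qed.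

(** Helly's theorem for arbitrary families: finite intersections are handled by
    the finite theorem, and compactness of [A] passes to the whole family. *)
Lemma helly_compact {R : realType} {d : nat} {I : choiceType}
    (A : set 'rV[R]_d) (C : I -> set 'rV[R]_d) :
  compact A -> convexs A -> A !=set0 ->
  (forall i, closed (C i)) -> (forall i, convexs (C i)) ->
  (forall g : 'I_d.+1 -> I, exists2 y, A y & forall k, C (g k) y) ->
  exists2 y, A y & forall i, C i y.
Proof.
move=> cA kA [a Aa] clC kC hC.
have kAC i : convexs (A `&` C i).
  by move=> x y t [Ax Cx] [Ay Cy] t01; split; [exact: kA|exact: kC].
have hAC (g : 'I_d.+1 -> I) : exists y, forall k, (A `&` C (g k)) y.
  by have [y Ay Cy] := hC g; exists y.
(* The index [None] stands for [A] itself, so that the common point lies in [A]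
   even when [I] is empty. *)
move: cA; rewrite compact_In0 => /(_ (option I) setT
  (fun o => A `&` if o is Some i then C i else setT)).
case.
- by exists (fun o => if o is Some i then C i else setT) => // -[i|] _ //.
- move=> D _.
  have fin (s : seq I) : exists2 y, A y & forall i, i \in s -> C i y.
    case: s => [|i0 s]; first by exists a.
    have [y Cy] := helly_finite _ kAC hAC _ (fun k : 'I_(size (i0 :: s)) =>
      nth i0 (i0 :: s) k).
    exists y; first by have [] := Cy ord0.
    move=> i /(nthP i0)[k ks <-].
    by have [_] := Cy (Ordinal ks).
  have [y Ay Cy] := fin (pmap id (finmap.enum_fset D)).
  exists y => -[i|] /= Di; split => //; apply: Cy.
  by rewrite mem_pmap map_id.
- by move=> y ACy; exists y => [|i]; [have [] := ACy None Logic.I|have [] := ACy (Some i) Logic.I].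
Qed.

(** * Derivatives of linear combinations *)

(** Properness makes limits of difference quotients unique, also at the endpoints
    of the segment. *)
Lemma within_segment_proper {R : realType} (T x : R) :
  0 < T -> x \in `[0, T] -> ProperFilter (within `[0, T] x^').
Proof.
move=> T0; rewrite in_itv /= => /andP[x0 xT].
apply: Build_ProperFilter_ex => A.
rewrite /within /= => /nbhs_ballP[e /= e0 eA].
have [xltT|Tx] := ltP x T.
  exists (Num.min (x + e / 2) T).
  have xm : x < Num.min (x + e / 2) T.
    by rewrite lt_min xltT andbT ltrDl divr_gt0.
  apply: eA; rewrite /ball /=; last 2 first.
  - by rewrite gt_eqF.
  - by rewrite in_itv /= (le_trans x0 (ltW xm)) /= ge_min lexx orbT.
  rewrite /ball_ /= distrC ger0_norm ?subr_ge0 ?(ltW xm) // ltrBlDl.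
  by rewrite gt_min ltrD2l gtr_pMr // invf_lt1 ?ltr1n.
exists (Num.max (x - e / 2) 0).
have xm : Num.max (x - e / 2) 0 < x.
  by rewrite gt_max (lt_le_trans T0 Tx) andbT gtrBl divr_gt0.
apply: eA; rewrite /ball /=; last 2 first.
- by rewrite lt_eqF.
- by rewrite in_itv /= le_max lexx orbT /= (le_trans (ltW xm) xT).
rewrite /ball_ /= ger0_norm ?subr_ge0 ?(ltW xm) // ltrBlDr -ltrBlDl.
by rewrite lt_max ltrD2l ltrN2 gtr_pMr // invf_lt1 ?ltr1n.
Qed.

(** Higher derivatives of a linear combination are only known on the segment, so
    the induction on the order of differentiation needs this locality. *)
Lemma eq_quotients {R : realType} (T : R) (f g : R -> R) (x : R) :
  {in `[0, T], f =1 g} -> x \in `[0, T] -> quotients T f x = quotients T g x.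
Proof.
move=> fg xT; have sub (u v : R -> R) : {in `[0, T], u =1 v} ->
    quotients T u x `=>` quotients T v x.
  move=> uv; apply: near_eq_cvg; have := near_withinT `[0, T]%classic (dnbhs_filter x).
  by apply: filterS => y yT; rewrite !uv.
by apply/seteqP; split; apply: sub => // y yT; rewrite fg.
Qed.

Lemma derivable_on_cvg {R : realType} (T : R) (f : R -> R) (x : R) :
  derivable_on T f -> x \in `[0, T] -> quotients T f x --> deriv_on T f x.
Proof. by move=> df xT; exact: df. Qed.

Lemma deriv_on_lin {R : realType} (T : R) (N : nat) (c : 'I_N -> R)
    (F : 'I_N -> R -> R) (x : R) :
  0 < T -> (forall i, derivable_on T (F i)) -> x \in `[0, T] ->
  deriv_on T (fun t => \sum_i c i * F i t) x = \sum_i c i * deriv_on T (F i) x.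
Proof.
move=> T0 dF xT.
have pF := within_segment_proper T x T0 xT.
suff H : quotients T (fun t => \sum_i c i * F i t) x
    --> \sum_i c i * deriv_on T (F i) x.
  by rewrite /deriv_on; apply: cvg_lim.
have qE : (fun y => (\sum_i c i * F i y - \sum_i c i * F i x) / (y - x)) =
    (fun y => \sum_i c i * ((F i y - F i x) / (y - x))).
  apply/funext => y; rewrite -sumrB mulr_suml.
  by apply: eq_bigr => i _; rewrite -mulrBr mulrA.
rewrite /quotients qE.
apply: cvg_big => [|i _]; last by apply: cvgMr; exact: derivable_on_cvg.
exact: add_continuous.
Qed.

Lemma derivn_on_lin {R : realType} (T : R) (N j : nat) (c : 'I_N -> R)
    (F : 'I_N -> R -> R) :
  0 < T -> (forall i k, (k < j)%N -> derivable_on T (derivn_on T k (F i))) ->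
  {in `[0, T], derivn_on T j (fun t => \sum_i c i * F i t)
    =1 fun t => \sum_i c i * derivn_on T j (F i) t}.
Proof.
move=> T0; elim: j => [//|j IH] dF t tT /=.
have dFj i k : (k < j)%N -> derivable_on T (derivn_on T k (F i)).
  by move=> kj; apply: dF; exact: ltnW.
rewrite -deriv_on_lin // /deriv_on; last by move=> i; exact: dF.
by congr (lim _); apply: eq_quotients => //; exact: IH.
Qed.

(** Near [x], [f y = f x + q y * (y - x)] with a convergent quotient [q]. *)
Lemma derivable_on_continuous {R : realType} (T : R) (f : R -> R) :
  0 < T -> derivable_on T f -> {within `[0, T], continuous f}.
Proof.
move=> T0 df; apply/subspace_continuousP => x xT.
have {}xT : x \in `[0, T] by [].
have pF := within_segment_proper T x T0 xT.
have q_cvg : (f y - f x) / (y - x) @[y --> within `[0, T] x^'] --> deriv_on T f x.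
  exact: derivable_on_cvg.
have id_cvg : y @[y --> within `[0, T] x^'] --> x.
  by move=> A Ax; rewrite /within /=; apply: filterS Ax => y.
have f_cvg : f x + (f y - f x) / (y - x) * (y - x) @[y --> within `[0, T] x^']
    --> f x + deriv_on T f x * (x - x).
  by apply: cvgD; [exact: cvg_cst|apply: cvgM => //; apply: cvgB => //; exact: cvg_cst].
rewrite subrr mulr0 addr0 in f_cvg.
move=> A Ax; have fxA : A (f x) by exact: nbhs_singleton.
have : within `[0, T] x^' ((fun y => f x + (f y - f x) / (y - x) * (y - x)) @^-1` A).
  exact: f_cvg.
change (within `[0, T] x^' ((fun y => f x + (f y - f x) / (y - x) * (y - x)) @^-1` A)
  -> within `[0, T] (nbhs x) (f @^-1` A)).
move=> nA; apply: (@filterS _ (nbhs x) _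
  (fun y => y != x -> y \in `[0, T] -> A (f x + (f y - f x) / (y - x) * (y - x)))) nA.
move=> y fA yT; have [->|yx] := eqVneq y x; first exact: fxA.
by move: (fA yx yT); rewrite divfK ?subr_eq0 // addrC subrK.
Qed.

(** * Closed convex sets cut out by linear functionals *)

Definition lincomb {R : realType} {N : nat} (F : 'I_N -> R -> R)
    (c : 'rV[R]_N) (t : R) : R := \sum_(i < N) c 0 i * F i t.

Definition convex_fun {R : realType} {V : lmodType R} (p : V -> R) : Prop :=
  forall x y (t : R), 0 <= t <= 1 ->
    p (t *: x + (1 - t) *: y) <= t * p x + (1 - t) * p y.

Lemma continuous_sum {R : realType} (T : topologicalType) (I : finType) (f : I -> T -> R) :
  (forall i, continuous (f i)) -> continuous (fun x => \sum_i f i x).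
Proof.
by move=> cf x; apply: cvg_big => [|i _]; [exact: add_continuous|exact: cf].
Qed.

Lemma closed_sublevel {R : realType} (T : topologicalType) (p : T -> R) (M : R) :
  continuous p -> closed [set x | p x <= M].
Proof. by move=> /continuous_closedP cp; apply: (cp [set y | y <= M]); exact: closed_le. Qed.

Section lincomb.
Context {R : realType} {N : nat}.
Implicit Types (F : 'I_N -> R -> R) (c x y : 'rV[R]_N).

Lemma sum_affine (a : 'I_N -> R) x y (s t : R) :
  \sum_i (s *: x + t *: y) 0 i * a i =
  s * (\sum_i x 0 i * a i) + t * \sum_i y 0 i * a i.
Proof.
rewrite !mulr_sumr -big_split /=; apply: eq_bigr => i _.
by rewrite !mxE mulrDl !mulrA.
Qed.

Lemma lincomb_affine F x y (s t u : R) :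
  lincomb F (s *: x + t *: y) u = s * lincomb F x u + t * lincomb F y u.
Proof. exact: sum_affine. Qed.

Lemma continuous_linear (a : 'I_N -> R) :
  continuous (fun c => \sum_i c 0 i * a i).
Proof.
apply: continuous_sum => i x.
by apply: continuousM; [exact: coord_continuous|exact: cst_continuous].
Qed.

End lincomb.

Section convex_functions.
Context {R : realType} {V : lmodType R}.
Implicit Types p q : V -> R.

Lemma convexs_sublevel p (M : R) : convex_fun p -> convexs [set x | p x <= M].
Proof.
move=> cp x y t /= px py t01; apply: le_trans (cp x y t t01) _.
have -> : M = t * M + (1 - t) * M by ring.
by case/andP: t01 => t0 t1; rewrite lerD // ler_wpM2l // subr_ge0.
Qed.

Lemma convex_funD p q :
  convex_fun p -> convex_fun q -> convex_fun (fun x => p x + q x).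
Proof.
move=> cp cq x y t t01; apply: le_trans (lerD (cp x y t t01) (cq x y t t01)) _.
by rewrite !mulrDr addrACA.
Qed.

Lemma convex_funZ (k : R) p :
  0 <= k -> convex_fun p -> convex_fun (fun x => k * p x).
Proof.
move=> k0 cp x y t t01; apply: le_trans (ler_wpM2l k0 (cp x y t t01)) _.
by rewrite mulrDr !(mulrCA k).
Qed.

Lemma convex_fun_sum (I : finType) (p : I -> V -> R) :
  (forall i, convex_fun (p i)) -> convex_fun (fun x => \sum_i p i x).
Proof.
move=> cp x y t t01; rewrite !mulr_sumr -big_split /=.
by apply: ler_sum => i _; exact: cp.
Qed.

End convex_functions.

Lemma convex_fun_abs {R : realType} {N : nat} (a : 'I_N -> R) :
  convex_fun (fun c : 'rV[R]_N => `|\sum_i c 0 i * a i|).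
Proof.
move=> x y t /andP[t0 t1]; rewrite sum_affine; apply: le_trans (ler_normD _ _) _.
by rewrite !normrM (ger0_norm t0) (@ger0_norm _ (1 - t)) // subr_ge0.
Qed.

(** * Norm balls of linear combinations *)

(** The form in which suprema are peeled off one by one from the sum that defines
    the norm; [b] may be infinite. *)
Lemma ereal_supD_le {R : realType} {I : Type} (D : set I) (p : I -> R)
    (b : \bar R) (M : R) :
  D !=set0 -> (forall i, D i -> ((p i)%:E + b <= M%:E)%E) ->
  (ereal_sup [set (p i)%:E | i in D] + b <= M%:E)%E.
Proof.
move=> [i0 Di0]; case: b => [r|/(_ _ Di0)|_] //; last by rewrite addeNy leNye.
by move=> h; rewrite -leeBrDr //; apply/ereal_supP => _ [i Di <-]; rewrite leeBrDr //; exact: h.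
Qed.

(** A sum of suprema over independent indices is the supremum of the sums, so a
    norm ball is an intersection of sublevel sets indexed by tuples of points. *)
Lemma C3rho_norm_le {R : realType} (rho T : R) (f : R -> R) (M : R) :
  0 < T ->
  (C3rho_norm rho T f <= M%:E)%E <->
  (forall (t : 'I_4 -> R) (s : R * R), (forall j, t j \in `[0, T]) ->
    [/\ s.1 \in `[0, T], s.2 \in `[0, T] & s.1 != s.2] ->
    \sum_(j < 4) `|derivn_on T j f (t j)|
    + `|derivn_on T 3 f s.1 - derivn_on T 3 f s.2| / `|s.1 - s.2| `^ rho <= M).
Proof.
move=> T0.
have i0 : 0 \in `[0, T] by rewrite in_itv /= lexx ltW.
have iT : T \in `[0, T] by rewrite in_itv /= lexx ltW.
have ne1 : `[0, T]%classic !=set0 by exists 0.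
have ne2 : [set st : R * R |
    [/\ st.1 \in `[0, T], st.2 \in `[0, T] & st.1 != st.2]] !=set0.
  by exists (0, T); split => //=; rewrite lt_eqF.
split=> [nM t s tT sT|h].
  rewrite -lee_fin; apply: le_trans nM.
  rewrite EFinD -sumEFin; apply: leeD; last by apply: ereal_sup_ubound; exists s.
  by apply: lee_sum => j _; apply: ereal_sup_ubound; exists (t j) => //; exact: tT.
rewrite /C3rho_norm /holder_seminorm /sup_norm !big_ord_recl big_ord0 adde0 -!addeA.
apply: (ereal_supD_le _ (fun t => `|derivn_on T 0 f t|)) => // t0 t0T; rewrite [leLHS]addeCA.
apply: (ereal_supD_le _ (fun t => `|derivn_on T 1 f t|)) => // t1 t1T.
rewrite [leLHS]addeA -EFinD [leLHS]addeCA.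
apply: (ereal_supD_le _ (fun t => `|derivn_on T 2 f t|)) => // t2 t2T.
rewrite [leLHS]addeA -EFinD [leLHS]addeCA.
apply: (ereal_supD_le _ (fun t => `|derivn_on T 3 f t|)) => // t3 t3T.
rewrite [leLHS]addeA -EFinD [leLHS]addeC.
apply: (ereal_supD_le _ (fun st =>
  `|derivn_on T 3 f st.1 - derivn_on T 3 f st.2| / `|st.1 - st.2| `^ rho)) => // s sT.
rewrite -EFinD lee_fin.
pose t : 'I_4 -> R := fun j => nth 0 [:: t0; t1; t2; t3] j.
have : forall j, t j \in `[0, T] by rewrite /t => -[[|[|[|[|]]]]].
move=> /(h t s)/(_ sT); rewrite !big_ord_recl big_ord0 /t /= => le_M.
by apply: le_trans le_M; lra.
Qed.

(** The first term of the norm is the uniform norm. *)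
Lemma C3rho_norm_abs_le {R : realType} (rho T : R) (f : R -> R) (M : R) :
  0 < T -> (C3rho_norm rho T f <= M%:E)%E ->
  forall t, t \in `[0, T] -> `|f t| <= M.
Proof.
move=> T0 /(C3rho_norm_le _ _ _ _ T0) h t tT.
have sT : [/\ (0 : R, T).1 \in `[0, T], (0 : R, T).2 \in `[0, T] &
    (0 : R, T).1 != (0 : R, T).2].
  by rewrite /= !in_itv /= !lexx ltW // lt_eqF.
apply: le_trans (h (fun=> t) (0, T) (fun=> tT) sT).
by rewrite big_ord_recl /= -addrA lerDl addr_ge0 ?sumr_ge0.
Qed.

Section norm_ball.
Context {R : realType} {N : nat} (rho T : R) (F : 'I_N -> R -> R) (M : R)
  (T0 : 0 < T) (CF : forall i, C3rho rho T (F i)).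

Let ball := [set c : 'rV[R]_N | (C3rho_norm rho T (lincomb F c) <= M%:E)%E].

(** A constraint of [C3rho_norm_le], rewritten as a sum of absolute values of
    linear functionals of the coefficients. *)
Let p (t : 'I_4 -> R) (s : R * R) (c : 'rV[R]_N) : R :=
  \sum_(j < 4) `|\sum_i c 0 i * derivn_on T j (F i) (t j)|
  + (`|s.1 - s.2| `^ rho)^-1 *
    `|\sum_i c 0 i * (derivn_on T 3 (F i) s.1 - derivn_on T 3 (F i) s.2)|.

Let index (ts : ('I_4 -> R) * (R * R)) : Prop :=
  (forall j, ts.1 j \in `[0, T]) /\
  [/\ ts.2.1 \in `[0, T], ts.2.2 \in `[0, T] & ts.2.1 != ts.2.2].

Let derivable_F j i k : (j <= 3)%N -> (k < j)%N ->
  derivable_on T (derivn_on T k (F i)).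
Proof. by move=> j3 kj; have [dF _ _] := CF i; apply/dF/(leq_trans kj). Qed.

Let ballE : ball = \bigcap_(ts in index) [set c | p ts.1 ts.2 c <= M].
Proof.
have pE t s c : index (t, s) -> p t s c =
    \sum_(j < 4) `|derivn_on T j (lincomb F c) (t j)|
    + `|derivn_on T 3 (lincomb F c) s.1 - derivn_on T 3 (lincomb F c) s.2|
      / `|s.1 - s.2| `^ rho.
  rewrite /lincomb => -[tT [s1T s2T _]]; congr (_ + _).
    apply: eq_bigr => j _; rewrite (derivn_on_lin T N j (fun i => c 0 i) F) // => i k.
    by apply: derivable_F; rewrite -ltnS.
  rewrite [LHS]mulrC !(derivn_on_lin T N 3 (fun i => c 0 i) F) //;
    try by move=> i k; exact: derivable_F.
  by rewrite -sumrB; congr (`|_| / _); apply: eq_bigr => i _; rewrite mulrBr.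
apply/seteqP; split=> c /=.
  by move=> /(C3rho_norm_le _ _ _ _ T0) h [t s] [/= tT sT]; rewrite pE //; exact: h.
move=> h; apply/C3rho_norm_le => // t s tT sT.
by rewrite -pE //; exact: (h (t, s)).
Qed.

Let p_convex t s : convex_fun (p t s).
Proof.
rewrite /p; apply: convex_funD; first by apply: convex_fun_sum => j; exact: convex_fun_abs.
by apply: convex_funZ; [rewrite invr_ge0 powR_ge0|exact: convex_fun_abs].
Qed.

Let p_continuous t s : continuous (p t s).
Proof.
have cabs (a : 'I_N -> R) : continuous (fun c : 'rV[R]_N => `|\sum_i c 0 i * a i|).
  move=> c; have lin := @continuous_linear R N a c.
  by have := continuous_comp lin (@norm_continuous R R _); exact.
rewrite /p => c; apply: (@continuousD _ R^o 'rV[R]_N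
  (fun c => \sum_(j < 4) `|\sum_i c 0 i * derivn_on T j (F i) (t j)|)).
  by apply: continuous_sum => j; exact: cabs.
by apply: continuousM; [exact: cst_continuous|exact: cabs].
Qed.

Lemma closed_norm_ball : closed ball.
Proof. by rewrite ballE; apply: closed_bigI => ts _; exact: closed_sublevel. Qed.

Lemma convexs_norm_ball : convexs ball.
Proof.
rewrite ballE => x y t px py t01 ts its.
by apply: convexs_sublevel => //; [exact: px|exact: py].
Qed.

End norm_ball.

(** * Coefficients are controlled by values *)

Section matrix_norm.
Context {R : realType} {m n : nat}.
Implicit Types x : 'M[R]_(m, n).

Lemma ler_mx_norm_entry x i j : `|x i j| <= `|x|.
Proof.
rewrite [leRHS]/Num.Def.normr /= mx_normrE.
exact: (le_bigmax _ (fun ij : 'I_m * 'I_n => `|x ij.1 ij.2|) (i, j)).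
Qed.

Lemma mx_norm_ler x (K : R) :
  0 <= K -> (forall i j, `|x i j| <= K) -> `|x| <= K.
Proof.
move=> K0 xK; rewrite [leLHS]/Num.Def.normr /= mx_normrE.
by apply: bigmax_le => // -[i j] _; exact: xK.
Qed.

End matrix_norm.

(** As long as the evaluations at finitely many points have a common kernel
    vector, one more point lowers the dimension of that kernel. *)
Lemma lin_indep_points {R : realType} {N : nat} (T : R) (F : 'I_N -> R -> R)
    (k : nat) : lin_indep T F -> (k <= N)%N ->
  exists (m : nat) (t : 'I_m -> R), (forall l, t l \in `[0, T]) /\
    (k <= \rank (\matrix_(i < N, l < m) F i (t l)))%N.
Proof.
move=> iF; elim: k => [_|k IH kN]; first by exists 0%N, (fun=> 0); split => // -[].
have [m [t [tT rk]]] := IH (ltnW kN); set E := \matrix_(i, l) _ in rk.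
have [rk1|rk1] := ltnP k (\rank E); first by exists m, t.
have kE : kermx E != 0.
  rewrite kermx_eq0 /row_free; apply: contraTneq kN => rN.
  by rewrite -leqNgt -{1}rN.
pose c := nz_row (kermx E).
have c0 : c != 0 by rewrite nz_row_eq0.
have cE : c *m E = 0 by apply/sub_kermxP; exact: nz_row_sub.
have [u [uT cu]] : exists u, u \in `[0, T] /\ \sum_i c 0 i * F i u != 0.
  apply: contrapT => nu; move/eqP: c0; apply; apply: iF => u uT.
  by apply: contrapT => /eqP cu; apply: nu; exists u.
exists (m + 1)%N, (fun l => match fintype.split l with inl l => t l | inr _ => u end).
split=> [l|]; first by case: (fintype.split l).
set E' := \matrix_(i, l) _.
have E'E : E' = row_mx E (\col_i F i u).
  by apply/matrixP => i l; rewrite !mxE; case: (fintype.split l) => ?; rewrite mxE.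
apply: leq_ltn_trans rk _; rewrite -mxrank_tr -(mxrank_tr E'); apply: rank_ltmx.
rewrite ltmxE E'E tr_row_mx; apply/andP; split.
  by apply/submxP; exists (row_mx 1%:M 0); rewrite mul_row_col mul1mx mul0mx addr0.
apply: contra cu => /submxP[D eD].
have /eqP : (col_mx E^T (\col_i F i u)^T) *m c^T = 0.
  by rewrite eD -mulmxA -trmx_mul cE trmx0 mulmx0.
rewrite mul_col_mx col_mx_eq0 => /andP[_ /eqP/matrixP/(_ 0 0)].
rewrite !mxE => e; apply/eqP; rewrite -[RHS]e; apply: eq_bigr => i _.
by rewrite !mxE mulrC.
Qed.

(** The evaluations at suitable points form an injective linear map of the
    coefficients, inverted by [pinvmx]. *)
Lemma lin_indep_bounded {R : realType} {N : nat} (T : R) (F : 'I_N -> R -> R)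
    (M : R) : lin_indep T F -> 0 <= M ->
  exists K, forall c : 'rV[R]_N,
    (forall t, t \in `[0, T] -> `|lincomb F c t| <= M) -> `|c| <= K.
Proof.
move=> iF M0; have [m [t [tT rE]]] := lin_indep_points T F N iF (leqnn N).
set E := \matrix_(i, l) _ in rE.
have fE : row_free E by rewrite /row_free eqn_leq rank_leq_row.
exists (\sum_j \sum_l M * `|pinvmx E l j|) => c cM.
apply: mx_norm_ler => [|i j].
  by apply: sumr_ge0 => j _; apply: sumr_ge0 => l _; rewrite mulr_ge0.
rewrite -[c](mulmxKp fE) mxE; apply: le_trans (ler_norm_sum _ _ _) _.
rewrite [leRHS](bigD1 j) //=; apply: ler_wpDr.
  by apply: sumr_ge0 => k _; apply: sumr_ge0 => l _; rewrite mulr_ge0.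
apply: ler_sum => l _; rewrite normrM ler_wpM2r //.
rewrite (ord1 i); apply: le_trans (cM _ (tT l)).
by rewrite mxE /lincomb; under eq_bigr do rewrite mxE.
Qed.

(** * Continuity of the matrix exponential *)

(** Coefficients dominated by those of an exponential: this is stable under
    termwise differentiation. *)
Definition exp_dominated {R : realType} (c : nat -> R) : Prop :=
  exists D C : R,
    [/\ 0 <= D, 0 <= C & forall k, `|c k| <= D * (C ^+ k / k`!%:R)].

Section exp_dominated.
Context {R : realType}.
Implicit Types c : nat -> R.

Lemma exp_dominated_diffs c : exp_dominated c -> exp_dominated (pseries_diffs c).
Proof.
move=> [D [C [D0 C0 cD]]]; exists (D * C), C; split=> // [|k]; first exact: mulr_ge0.
rewrite /pseries_diffs normrM ger0_norm //.
apply: le_trans (ler_wpM2l (ler0n R _) (cD k.+1)) _.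
rewrite exprS factS natrM le_eqVlt; apply/orP; left; apply/eqP.
by field; rewrite (eqr_nat R k`! 0) -lt0n fact_gt0 addrC natr1 pnatr_eq0.
Qed.

Lemma exp_dominated_cvg c x : exp_dominated c -> cvgn (pseries c x).
Proof.
move=> [D [C [D0 C0 cD]]]; apply: normed_cvg.
apply: (@series_le_cvg _ _ (fun k => D * exp_coeff (C * `|x|) k)) => [k|k|k|].
- exact: normr_ge0.
- by rewrite mulr_ge0 // exp_coeff_ge0 // mulr_ge0.
- rewrite /exp_coeff /= normrM normrX exprMn.
  by apply: le_trans (ler_wpM2r _ (cD k)) _; rewrite ?exprn_ge0 // -!mulrA (mulrC (`|x| ^+ k)).
- by apply: is_cvg_seriesZ; exact: is_cvg_series_exp_coeff.
Qed.

Lemma exp_dominated_continuous c :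
  exp_dominated c -> continuous (fun x => limn (pseries c x)).
Proof.
move=> cD x; have c'D := exp_dominated_diffs _ cD.
have c''D := exp_dominated_diffs _ c'D.
have [] : is_derive x (1 : R) (fun x => limn (pseries c x))
    (limn (pseries (pseries_diffs c) x)).
  apply: (@pseries_snd_diffs _ _ (`|x| + 1)); try exact: exp_dominated_cvg.
  by rewrite [ltRHS]ger0_norm ?addr_ge0 // ltrDl.
by move=> /derivable1_diffP/differentiable_continuous.
Qed.

End exp_dominated.

(** With [C] the sum of the absolute values of the entries of [A], the entries of
    [A ^+ k] are bounded by [C ^+ k]. *)
Lemma expmx_entry_dominated {R : realType} (n : nat) (A : 'M[R]_n) i j :
  exp_dominated (fun k => (k`!%:R)^-1 * (A ^+ k) i j).
Proof.
pose C := \sum_i \sum_j `|A i j|.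
have C0 : 0 <= C by apply: sumr_ge0 => ? _; apply: sumr_ge0 => ? _.
have AC k : forall i, `|(A ^+ k) i j| <= C ^+ k.
  elim: k => [|k IH] {}i; first by rewrite !expr0 mxE; case: eqP; rewrite ?normr1 ?normr0.
  rewrite exprS mxE; apply: le_trans (ler_norm_sum _ _ _) _.
  apply: le_trans (_ : \sum_l `|A i l| * C ^+ k <= _).
    by apply: ler_sum => l _; rewrite normrM ler_wpM2l.
  rewrite -mulr_suml exprS ler_wpM2r ?exprn_ge0 //.
  by rewrite /C [leRHS](bigD1 i) //= lerDl; apply: sumr_ge0 => ? _; apply: sumr_ge0.
exists 1, C; split=> // k.
by rewrite mul1r mulrC normrM normfV normr_nat ler_wpM2r.
Qed.

Lemma continuous_expmx_entry {R : realType} (n : nat) (A : 'M[R]_n) (T : R) i j :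
  continuous (fun tau => expmx ((T - tau) *: A) i j).
Proof.
have -> : (fun tau => expmx ((T - tau) *: A) i j) =
    (fun x => limn (pseries (fun k => (k`!%:R)^-1 * (A ^+ k) i j) x)) \o
    (fun tau => T - tau).
  apply/funext => tau; rewrite /expmx mxE /=; congr (limn _); apply/funext => N.
  rewrite /pseries /series /= big_mkord; apply: eq_bigr => k _.
  have -> : ((T - tau) *: A) ^+ k = (T - tau) ^+ k *: A ^+ k.
    elim: (nat_of_ord k) => [|l IH]; first by rewrite !expr0 scale1r.
    rewrite !exprS IH; change ((T - tau) *: A *m ((T - tau) ^+ l *: A ^+ l) =
      ((T - tau) * (T - tau) ^+ l) *: (A *m A ^+ l)).
    by rewrite -scalemxAl -scalemxAr scalerA.
  by rewrite mxE -mulrA (mulrC (_ ^+ k)).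
move=> tau; apply: continuous_comp.
  by apply: continuousB; [exact: cst_continuous|].
exact/exp_dominated_continuous/expmx_entry_dominated.
Qed.

(** * Integrals of linear combinations *)

Section segment_integral.
Context {R : realType} (T : R).
Implicit Types f g : R -> R.

Definition cont_on f : Prop := {within `[0, T], continuous f}.

Lemma cont_onM f g : cont_on f -> cont_on g -> cont_on (fun t => f t * g t).
Proof. by move=> cf cg x; apply: continuousM; [exact: cf|exact: cg]. Qed.

Lemma cont_onD f g : cont_on f -> cont_on g -> cont_on (fun t => f t + g t).
Proof. by move=> cf cg x; apply: cvgD; [exact: cf|exact: cg]. Qed.

Lemma cont_on_lincomb N (F : 'I_N -> R -> R) (c : 'rV[R]_N) :
  (forall i, cont_on (F i)) -> cont_on (lincomb F c).
Proof.
move=> cF; rewrite /cont_on /lincomb.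
apply: (@continuous_sum R (subspace `[0, T]%classic) _ (fun i t => c 0 i * F i t)) => i x.
by apply: continuousM; [exact: cst_continuous|exact: cF].
Qed.

Lemma cont_on_integrable f :
  cont_on f -> lebesgue_measure.-integrable `[0, T] (EFin \o f).
Proof. by move=> cf; apply: continuous_compact_integrable => //; exact: segment_compact. Qed.

Lemma Rintegral_lincomb N (F : 'I_N -> R -> R) (k : R -> R) (c : 'rV[R]_N) :
  cont_on k -> (forall i, cont_on (F i)) ->
  \int[lebesgue_measure]_(t in `[0, T]) (k t * lincomb F c t) =
  \sum_i c 0 i * \int[lebesgue_measure]_(t in `[0, T]) (k t * F i t).
Proof.
move=> ck cF; have ckF i : cont_on (fun t => k t * F i t) by exact: cont_onM.
have intZ i : lebesgue_measure.-integrable `[0, T] (EFin \o fun t => c 0 i * (k t * F i t)).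
  by apply: cont_on_integrable; apply: cont_onM => // x; exact: cst_continuous.
under eq_Rintegral => t _.
  rewrite /lincomb mulr_sumr; under eq_bigr do rewrite mulrCA.
  over.
have csum (s : seq 'I_N) : cont_on (fun t => \sum_(i <- s) c 0 i * (k t * F i t)).
  move=> x; apply: cvg_big => [|i _]; first exact: add_continuous.
  have cc : cont_on (cst (c 0 i)) by move=> z; exact: cst_continuous.
  exact: (cont_onM _ _ cc (ckF i)).
transitivity (\sum_i \int[lebesgue_measure]_(t in `[0, T]) (c 0 i * (k t * F i t))).
  elim: (index_enum _) => [|i s IH].
    rewrite big_nil; under eq_Rintegral do rewrite big_nil.
    by rewrite Rintegral_cst // mul0r.
  rewrite big_cons -IH -RintegralD //; last exact: cont_on_integrable.
  by apply: eq_Rintegral => t _; rewrite big_cons.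
by apply: eq_bigr => i _; rewrite RintegralZl //; exact: cont_on_integrable.
Qed.

Lemma Rintegral_sqr_lincomb N (F : 'I_N -> R -> R) (c : 'rV[R]_N) :
  (forall i, cont_on (F i)) ->
  \int[lebesgue_measure]_(t in `[0, T]) (lincomb F c t ^+ 2) =
  \sum_i c 0 i *
    \sum_j c 0 j * \int[lebesgue_measure]_(t in `[0, T]) (F i t * F j t).
Proof.
move=> cF; under eq_Rintegral do rewrite expr2.
rewrite Rintegral_lincomb //; last exact: cont_on_lincomb.
apply: eq_bigr => i _; congr (_ * _); rewrite -Rintegral_lincomb //.
by apply: eq_Rintegral => t _; rewrite mulrC.
Qed.

(** The square is convex at each time, and integration is monotone and linear. *)
Lemma convex_Rintegral_sqr N (F : 'I_N -> R -> R) :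
  (forall i, cont_on (F i)) ->
  convex_fun (fun c : 'rV[R]_N =>
    \int[lebesgue_measure]_(t in `[0, T]) (lincomb F c t ^+ 2)).
Proof.
move=> cF x y s /andP[s0 s1].
have csq c : cont_on (fun t => lincomb F c t ^+ 2).
  by apply: cont_onM; exact: cont_on_lincomb.
have csqZ r c : cont_on (fun t => r * lincomb F c t ^+ 2).
  by apply: cont_onM => // z; exact: cst_continuous.
have mI : measurable (`[0, T]%classic : set R) by [].
rewrite -!RintegralZl //; try exact: cont_on_integrable.
rewrite -RintegralD //; try exact: cont_on_integrable.
apply: le_Rintegral => //.
- exact: cont_on_integrable.
- by apply: cont_on_integrable; apply: cont_onD.
- move=> t _; rewrite lincomb_affine -subr_ge0.
  set a := lincomb F x t; set b := lincomb F y t.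
  have -> : s * a ^+ 2 + (1 - s) * b ^+ 2 - (s * a + (1 - s) * b) ^+ 2 =
    s * (1 - s) * (a - b) ^+ 2 by ring.
  by rewrite mulr_ge0 ?sqr_ge0 // mulr_ge0 // subr_ge0.
Qed.

End segment_integral.

(** * The cost as a polynomial in the parameters *)

(** Functions bounded on [A * B], and Lipschitz continuous in the second
    variable there, uniformly in the first. The bound is part of the predicate
    because products of Lipschitz functions need it. *)
Definition unif_lip {R : realType} {U V : normedModType R} (A : set U) (B : set V)
    (f : U -> V -> R) : Prop :=
  exists K : R, 0 <= K /\ forall a b b', A a -> B b -> B b' ->
    `|f a b| <= K /\ `|f a b - f a b'| <= K * `|b - b'|.

Section unif_lip.
Context {R : realType} {U V : normedModType R} (A : set U) (B : set V).
Implicit Types f g : U -> V -> R.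

Lemma unif_lip_cst k : unif_lip A B (fun _ _ => k).
Proof.
by exists `|k|; split=> // a b b' _ _ _; rewrite subrr normr0 mulr_ge0.
Qed.

Lemma unif_lipD f g :
  unif_lip A B f -> unif_lip A B g -> unif_lip A B (fun a b => f a b + g a b).
Proof.
move=> [K [K0 fK]] [L [L0 gL]]; exists (K + L); split=> [|a b b' Aa Bb Bb'].
  exact: addr_ge0.
have [f1 f2] := fK _ _ _ Aa Bb Bb'; have [g1 g2] := gL _ _ _ Aa Bb Bb'.
split; first exact: le_trans (ler_normD _ _) (lerD f1 g1).
rewrite opprD addrACA mulrDl.
exact: le_trans (ler_normD _ _) (lerD f2 g2).
Qed.

Lemma unif_lipM f g :
  unif_lip A B f -> unif_lip A B g -> unif_lip A B (fun a b => f a b * g a b).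
Proof.
move=> [K [K0 fK]] [L [L0 gL]]; exists (K * L + K * L); split=> [|a b b' Aa Bb Bb'].
  by rewrite addr_ge0 ?mulr_ge0.
have [f1 f2] := fK _ _ _ Aa Bb Bb'; have [g1 g2] := gL _ _ _ Aa Bb Bb'.
have [g1' _] := gL _ _ _ Aa Bb' Bb.
split; first by rewrite normrM; apply: ler_wpDr; [exact: mulr_ge0|exact: ler_pM].
have -> : f a b * g a b - f a b' * g a b' =
    f a b * (g a b - g a b') + (f a b - f a b') * g a b' by ring.
apply: le_trans (ler_normD _ _) _; rewrite !normrM mulrDl; apply: lerD.
  by rewrite -mulrA; apply: ler_pM.
by rewrite mulrAC; apply: ler_pM.
Qed.

Lemma unif_lip_sum (I : finType) (f : I -> U -> V -> R) :
  (forall i, unif_lip A B (f i)) -> unif_lip A B (fun a b => \sum_i f i a b).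
Proof.
move=> lf; elim: (index_enum I) => [|i s IH].
  have -> : (fun a b => \sum_(i <- [::]) f i a b) = (fun _ _ => 0).
    by apply/funext => a; apply/funext => b; rewrite big_nil.
  exact: unif_lip_cst.
have -> : (fun a b => \sum_(j <- i :: s) f j a b) =
    (fun a b => f i a b + \sum_(j <- s) f j a b).
  by apply/funext => a; apply/funext => b; rewrite big_cons.
exact: unif_lipD.
Qed.

End unif_lip.

Lemma unif_lip_coord1 {R : realType} {m : nat} {V : normedModType R}
    (A : set 'rV[R]_m) (B : set V) (K : R) i :
  (forall a, A a -> `|a| <= K) -> unif_lip A B (fun a _ => a 0 i).
Proof.
move=> AK; exists `|K|; split=> // a b b' Aa _ _; rewrite subrr normr0 mulr_ge0 //.
split=> //; apply: le_trans (ler_mx_norm_entry _ _ _) _.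
exact: le_trans (AK _ Aa) (ler_norm _).
Qed.

Lemma unif_lip_coord2 {R : realType} {n : nat} {U : normedModType R}
    (A : set U) (B : set 'rV[R]_n) (K : R) i :
  (forall b, B b -> `|b| <= K) -> unif_lip A B (fun _ b => b 0 i).
Proof.
move=> BK; exists (`|K| + 1); split=> [|a b b' _ Bb _]; first exact: addr_ge0.
split.
  apply: le_trans (ler_mx_norm_entry _ _ _) _.
  by apply: ler_wpDr => //; exact: le_trans (BK _ Bb) (ler_norm _).
have -> : b 0 i - b' 0 i = (b - b') 0 i by rewrite !mxE.
apply: le_trans (ler_mx_norm_entry _ _ _) _.
by rewrite mulrDl mul1r lerDr mulr_ge0.
Qed.

Section cost.
Context {R : realType} (P : sip_data R) (hP : standing P).
Implicit Types (alpha : 'rV[R]_(Nv P)) (beta : 'rV[R]_(Nw P)).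

Let sqr_int (f : R -> R) : R :=
  \int[lebesgue_measure]_(t in `[0, Tf P]) (f t ^+ 2).

Lemma C3rho_cont_on (f : R -> R) : C3rho (rho P) (Tf P) f -> cont_on (Tf P) f.
Proof.
by move=> [df _ _]; apply: derivable_on_continuous; [exact: T_gt0 hP|exact: (df 0%N)].
Qed.

Let psi_cont i : cont_on (Tf P) (psi P i).
Proof. exact/C3rho_cont_on/(psi_C3rho P hP). Qed.

Let phi_cont i : cont_on (Tf P) (phi P i).
Proof. exact/C3rho_cont_on/(phi_C3rho P hP). Qed.

Lemma final_state_affine zbar :
  exists (d : 'I_(zdim P) -> R) (p : 'I_(zdim P) -> 'I_(Nv P) -> R)
      (q : 'I_(zdim P) -> 'I_(Nw P) -> R),
    forall alpha beta i, (final_state P zbar alpha beta - zOmega P) i 0 =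
      d i + (\sum_j alpha 0 j * p i j + \sum_j beta 0 j * q i j).
Proof.
pose k i tau : R := (expmx ((Tf P - tau) *: An P) *m Bn P) i 0.
have ck i : cont_on (Tf P) (k i).
  have -> : k i = (fun tau => \sum_j expmx ((Tf P - tau) *: An P) i j * Bn P j 0).
    by apply/funext => tau; rewrite /k mxE.
  apply/continuous_subspaceT/continuous_sum => j x.
  apply: continuousM; last exact: cst_continuous.
  exact: continuous_expmx_entry.
exists (fun i => (expmx (Tf P *: An P) *m zbar - zOmega P) i 0),
  (fun i j => \int[lebesgue_measure]_(t in `[0, Tf P]) (k i t * psi P j t)),
  (fun i j => \int[lebesgue_measure]_(t in `[0, Tf P]) (k i t * phi P j t)).
move=> alpha beta i; rewrite /final_state addrAC mxE; congr (_ + _); rewrite mxE.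
rewrite -!Rintegral_lincomb // -RintegralD //; last 2 first.
- by apply: cont_on_integrable; apply: cont_onM => //; exact: cont_on_lincomb.
- by apply: cont_on_integrable; apply: cont_onM => //; exact: cont_on_lincomb.
by apply: eq_Rintegral => t _; rewrite mulrDr.
Qed.

(** The two energy terms are kept as integrals of squares: in this form convexity
    of the control energy is visible. *)
Lemma cost_expansion zbar :
  exists (d : 'I_(zdim P) -> R) (p : 'I_(zdim P) -> 'I_(Nv P) -> R)
      (q : 'I_(zdim P) -> 'I_(Nw P) -> R),
    forall alpha beta, cost P zbar alpha beta =
      (zdim P).+1%:R^-1 / 2 *
        \sum_i (d i + (\sum_j alpha 0 j * p i j + \sum_j beta 0 j * q i j)) ^+ 2
      + lambda P / 2 * sqr_int (lincomb (psi P) alpha)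
      - gamma P / 2 * sqr_int (lincomb (phi P) beta).
Proof.
have [d [p [q dpq]]] := final_state_affine zbar; exists d, p, q => alpha beta.
rewrite /cost /l2norm sqr_sqrtr; last by apply: sumr_ge0 => i _; exact: sqr_ge0.
by congr (_ * _ + _ - _); apply: eq_bigr => i _; rewrite dpq.
Qed.

(** The concave disturbance energy is constant in [alpha]; the other terms are
    squares of affine functions and the control energy. *)
Lemma cost_convex zbar beta : convex_fun (fun alpha => cost P zbar alpha beta).
Proof.
have [d [p [q dpq]]] := cost_expansion zbar.
under [X in convex_fun X]eq_fun do rewrite dpq.
apply: convex_funD; last first.
  by move=> x y t _; rewrite le_eqVlt; apply/orP; left; apply/eqP; ring.
apply: convex_funD; apply: convex_funZ.
- by rewrite mulr_ge0 // invr_ge0.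
- apply: convex_fun_sum => i x y t /andP[t0 t1]; rewrite sum_affine -subr_ge0.
  set b := \sum_j beta 0 j * _; set u := \sum_j x 0 j * _.
  set v := \sum_j y 0 j * _.
  rewrite (_ : _ - _ = t * (1 - t) * (u - v) ^+ 2); last by ring.
  by rewrite mulr_ge0 ?sqr_ge0 // mulr_ge0 // subr_ge0.
- by rewrite divr_ge0 // ltW // (lambda_gt0 P hP).
- exact: convex_Rintegral_sqr.
Qed.

(** Writing also the energies as quadratic forms displays the cost as a polynomial
    in the coordinates, from which continuity and Lipschitz bounds follow. *)
Lemma cost_polynomial zbar :
  exists (k : R) (d : 'I_(zdim P) -> R) (p : 'I_(zdim P) -> 'I_(Nv P) -> R)
      (q : 'I_(zdim P) -> 'I_(Nw P) -> R)
      (S : 'I_(Nv P) -> 'I_(Nv P) -> R) (D : 'I_(Nw P) -> 'I_(Nw P) -> R),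
    forall alpha beta, cost P zbar alpha beta =
      k * (\sum_i (d i + (\sum_j alpha 0 j * p i j + \sum_j beta 0 j * q i j)) *
                  (d i + (\sum_j alpha 0 j * p i j + \sum_j beta 0 j * q i j)))
      + (\sum_i alpha 0 i * \sum_j alpha 0 j * S i j
         + \sum_i beta 0 i * \sum_j beta 0 j * D i j).
Proof.
have [d [p [q dpq]]] := cost_expansion zbar.
exists ((zdim P).+1%:R^-1 / 2), d, p, q,
  (fun i j => lambda P / 2 *
    \int[lebesgue_measure]_(t in `[0, Tf P]) (psi P i t * psi P j t)),
  (fun i j => - (gamma P / 2) *
    \int[lebesgue_measure]_(t in `[0, Tf P]) (phi P i t * phi P j t)).
move=> alpha beta; rewrite dpq /sqr_int !Rintegral_sqr_lincomb // -addrA.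
have scale (N : nat) (c : 'rV[R]_N) (M : 'I_N -> 'I_N -> R) (r : R) :
    r * (\sum_i c 0 i * \sum_j c 0 j * M i j) =
    \sum_i c 0 i * \sum_j c 0 j * (r * M i j).
  rewrite mulr_sumr; apply: eq_bigr => i _; rewrite mulrCA; congr (_ * _).
  by rewrite mulr_sumr; apply: eq_bigr => j _; rewrite mulrCA.
by rewrite -mulNr !scale.
Qed.

Lemma cost_continuous zbar beta : continuous (fun alpha => cost P zbar alpha beta).
Proof.
have [k [d [p [q [S [D cE]]]]]] := cost_polynomial zbar.
under [X in continuous X]eq_fun do rewrite cE.
have cst (r : R) : continuous (fun _ : 'rV[R]_(Nv P) => r).
  by move=> x; exact: cst_continuous.
have cM (f g : 'rV[R]_(Nv P) -> R) : continuous f -> continuous g ->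
    continuous (fun x => f x * g x).
  by move=> cf cg x; apply: continuousM; [exact: cf|exact: cg].
have cD (f g : 'rV[R]_(Nv P) -> R) : continuous f -> continuous g ->
    continuous (fun x => f x + g x).
  by move=> cf cg x; apply: (@continuousD _ R^o _ f g); [exact: cf|exact: cg].
have caff i : continuous (fun alpha : 'rV[R]_(Nv P) =>
    d i + (\sum_j alpha 0 j * p i j + \sum_j beta 0 j * q i j)).
  by apply: (cD _ _); [exact: (cst _)|apply: (cD _ _); [exact: continuous_linear|exact: (cst _)]].
apply: (cD _ _); first by apply: (cM _ _) => //; apply: continuous_sum => i; exact: (cM _ _).
apply: (cD _ _); last exact: (cst _).
apply: continuous_sum => i; apply: (cM _ _); first exact: coord_continuous.
exact: continuous_linear.
Qed.

Lemma cost_unif_lip zbar (A : set 'rV[R]_(Nv P)) (B : set 'rV[R]_(Nw P)) (K L : R) :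
  (forall a, A a -> `|a| <= K) -> (forall b, B b -> `|b| <= L) ->
  unif_lip A B (cost P zbar).
Proof.
move=> AK BL; have [k [d [p [q [S [D cE]]]]]] := cost_polynomial zbar.
have cst r : unif_lip A B (fun _ _ => r) by exact: unif_lip_cst.
have a1 i : unif_lip A B (fun a _ => a 0 i) by exact: unif_lip_coord1 AK.
have b1 i : unif_lip A B (fun _ b => b 0 i) by exact: unif_lip_coord2 BL.
have -> : cost P zbar = fun alpha beta =>
  k * (\sum_i (d i + (\sum_j alpha 0 j * p i j + \sum_j beta 0 j * q i j)) *
              (d i + (\sum_j alpha 0 j * p i j + \sum_j beta 0 j * q i j)))
  + (\sum_i alpha 0 i * \sum_j alpha 0 j * S i j
     + \sum_i beta 0 i * \sum_j beta 0 j * D i j).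
  by apply/funext => alpha; apply/funext => beta; rewrite cE.
have af i : unif_lip A B (fun alpha beta =>
    d i + (\sum_j alpha 0 j * p i j + \sum_j beta 0 j * q i j)).
  apply: unif_lipD => //; apply: unif_lipD; apply: unif_lip_sum => j;
  by apply: unif_lipM.
apply: unif_lipD.
  by apply: unif_lipM => //; apply: unif_lip_sum => i; exact: unif_lipM.
apply: unif_lipD; apply: unif_lip_sum => i; apply: unif_lipM => //;
  apply: unif_lip_sum => j; exact: unif_lipM.
Qed.

End cost.

(** * The admissible sets *)

Lemma is_interval_convex {R : realType} (W : set R) (x y t : R) :
  is_interval W -> W x -> W y -> 0 <= t <= 1 -> W (t * x + (1 - t) * y).
Proof.
move=> iW Wx Wy /andP[t0 t1].
have [xy|/ltW yx] := leP x y; [apply: (iW _ _ Wx Wy)|apply: (iW _ _ Wy Wx)];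
  by apply/andP; split; nra.
Qed.

Section value_constraint.
Context {R : realType} {N : nat} (F : 'I_N -> R -> R) (t : R) (W : set R).

Lemma closed_value_constraint :
  closed W -> closed [set c : 'rV[R]_N | W (lincomb F c t)].
Proof. by move: W; apply/continuous_closedP; exact: continuous_linear. Qed.

Lemma convexs_value_constraint :
  is_interval W -> convexs [set c : 'rV[R]_N | W (lincomb F c t)].
Proof.
by move=> iW x y s /= Wx Wy s01; rewrite lincomb_affine; exact: is_interval_convex.
Qed.

End value_constraint.

Lemma closed_singleton {R : realType} (a : R) : closed [set a].
Proof.
by apply: accessible_closed_set1; apply: hausdorff_accessible; exact: Rhausdorff.
Qed.

Section admissible.
Context {R : realType} (P : sip_data R) (hP : standing P).

Lemma admB_closed : closed (admB P).
Proof.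
have -> : admB P =
    [set c | [set ybar P 1 - v0 P] (lincomb (phi P) c 0)] `&`
    ([set c | (C3rho_norm (rho P) (Tf P) (lincomb (phi P) c) <= (Mw P)%:E)%E] `&`
    \bigcap_(t in [set t | t \in `[0, Tf P]])
      [set c | WW P (lincomb (phi P) c t)]).
  apply/seteqP; split=> [b [b1 b2 b3]|b [/= b1 [b2 b3]]].
    by split; [rewrite /= -b1 addrAC subrr add0r|split].
  by split=> //; rewrite /disturbance -/(lincomb _ _ _) b1 addrC subrK.
apply: closedI; first exact: (closed_value_constraint _ _ [set _] (closed_singleton _)).
apply: closedI; first exact: (closed_norm_ball _ _ _ _ (T_gt0 P hP) (phi_C3rho P hP)).
apply: closed_bigI => t _; apply: closed_value_constraint.
by apply: compact_closed; [exact: Rhausdorff|exact: WW_compact P hP].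
Qed.

Let admAE : admA P =
  [set c | [set v0 P] (lincomb (psi P) c 0)] `&`
  ([set c | (C3rho_norm (rho P) (Tf P) (lincomb (psi P) c) <= (Mv P)%:E)%E] `&`
  \bigcap_(tb in [set tb : R * 'rV[R]_(Nw P) | tb.1 \in `[0, Tf P] /\ admB P tb.2])
    [set c | [set y | VV P (y + disturbance P tb.2 tb.1)] (lincomb (psi P) c tb.1)]).
Proof.
apply/seteqP; split=> [b [b1 b2 b3]|b [/= b1 [b2 b3]]].
  by split=> //; split=> // -[t c] /= [tT Bc]; exact: b3.
by split=> // t c tT Bc; exact: (b3 (t, c)).
Qed.

Lemma admA_closed : closed (admA P).
Proof.
rewrite admAE; apply: closedI.
  exact: (closed_value_constraint _ _ [set _] (closed_singleton _)).
apply: closedI; first exact: (closed_norm_ball _ _ _ _ (T_gt0 P hP) (psi_C3rho P hP)).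
apply: closed_bigI => tb _; apply: closed_value_constraint.
have : closed (VV P).
  by apply: compact_closed; [exact: Rhausdorff|exact: VV_compact P hP].
apply: (proj1 (continuous_closedP (fun y => y + disturbance P tb.2 tb.1))).
by move=> y; apply: (@continuousD _ R^o _ id); [|exact: cst_continuous].
Qed.

Lemma admA_convex : convexs (admA P).
Proof.
rewrite admAE => x y s [x1 [x2 x3]] [y1 [y2 y3]] s01; split; last split.
- apply: (convexs_value_constraint _ _ [set v0 P]) => // u v -> -> w.
  by rewrite -eq_le => /eqP.
- exact: (convexs_norm_ball _ _ _ _ (T_gt0 P hP) (psi_C3rho P hP)).
- move=> tb Htb; apply: (convexs_value_constraint _ _ [set y | VV P _]) => //.
  + move=> u v /= Vu Vv w /andP[uw wv].
    by apply: (VV_itv P hP _ _ Vu Vv); rewrite !lerD2r uw.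
  + exact: x3.
  + exact: y3.
Qed.

Lemma admA_bounded : exists K, forall alpha, admA P alpha -> `|alpha| <= K.
Proof.
have [K hK] := lin_indep_bounded _ _ _ (psi_indep P hP) (ltW (Mv_gt0 P hP)).
exists K => alpha [_ nA _]; apply: hK.
exact: (C3rho_norm_abs_le _ _ _ _ (T_gt0 P hP) nA).
Qed.

Lemma admB_bounded : exists K, forall beta, admB P beta -> `|beta| <= K.
Proof.
have [K hK] := lin_indep_bounded _ _ _ (phi_indep P hP) (ltW (Mw_gt0 P hP)).
exists K => beta [_ nB _]; apply: hK.
exact: (C3rho_norm_abs_le _ _ _ _ (T_gt0 P hP) nB).
Qed.

Lemma admA_compact : compact (admA P).
Proof.
apply: bounded_closed_compact; last exact: admA_closed.
have [K hK] := admA_bounded; exists K; split; first exact: num_real.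
by move=> M KM a Aa; apply: le_trans (hK _ Aa) (ltW KM).
Qed.

End admissible.

(** * The value function of the relaxation *)

Lemma lipschitz_within_continuous {R : realType} {V W : normedModType R}
    (D : set V) (f : V -> W) (K : R) :
  0 <= K -> (forall x y, D x -> D y -> `|f x - f y| <= K * `|x - y|) ->
  {within D, continuous f}.
Proof.
move=> K0 fK; apply/subspace_continuousP => x Dx; apply/cvgrPdist_le => e e0.
have K1 : 0 < K + 1 by rewrite ltr_wpDl.
have : \forall y \near x, `|x - y| <= e / (K + 1).
  by apply: cvgr_dist_le; [exact: cvg_id|exact: divr_gt0].
apply: filterS => y xy Dy; apply: le_trans (fK _ _ Dx Dy) _.
rewrite ler_pdivlMr // mulrC mulrDl mul1r in xy.
by apply: le_trans xy; rewrite lerDl.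
Qed.

Section relaxation.
Context {R : realType} (P : sip_data R) (hP : standing P) (zbar : 'cV[R]_(zdim P)).

Local Notation U := ('rV[R]_(Nv P).+1 * 'M[R]_((Nv P).+1, Nw P))%type.
Implicit Types (u : U) (alpha : 'rV[R]_(Nv P)).

(** The state constraint of the relaxation is already part of [admA], so that
    only the costs of the sampled disturbances remain. *)
Lemma relax_feasibleE u s alpha : UU P u ->
  relax_feasible P zbar u (s, alpha) <->
  admA P alpha /\ forall i, cost P zbar alpha (row i u.2) <= s.
Proof.
move=> Uu; split=> [[/= Aa h]|[Aa h]]; first by split=> // i; have [] := h i.
by split=> // i; have [tT Bi] := Uu i; have [a0 _ aV] := Aa; split=> //; exact: aV.
Qed.

Lemma G_le u s alpha : UU P u -> admA P alpha ->
  (forall i, cost P zbar alpha (row i u.2) <= s) -> (G P zbar u <= s%:E)%E.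
Proof.
move=> Uu Aa h; apply: ereal_inf_lbound; exists (s, alpha) => //.
exact/relax_feasibleE.
Qed.

Lemma G_ge u r : UU P u ->
  (forall s alpha, admA P alpha ->
    (forall i, cost P zbar alpha (row i u.2) <= s) -> r <= s) ->
  (r%:E <= G P zbar u)%E.
Proof.
move=> Uu h; apply: le_ereal_inf_tmp => _ [[s alpha] /relax_feasibleE - /(_ Uu)[Aa ca] <-].
by rewrite lee_fin; exact: h ca.
Qed.

Lemma G_lt u r : UU P u -> (G P zbar u < r%:E)%E ->
  exists2 alpha, admA P alpha & forall i, cost P zbar alpha (row i u.2) <= r.
Proof.
move=> Uu /ereal_inf_lt[_ [[s alpha] /relax_feasibleE - /(_ Uu)[Aa ca] <-]] /=.
by rewrite lte_fin => sr; exists alpha => // i; exact: le_trans (ca i) (ltW sr).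
Qed.

Lemma cost_lip : exists K, 0 <= K /\ forall alpha beta beta',
  admA P alpha -> admB P beta -> admB P beta' ->
  `|cost P zbar alpha beta| <= K /\
  `|cost P zbar alpha beta - cost P zbar alpha beta'| <= K * `|beta - beta'|.
Proof.
have [K hK] := admA_bounded P hP; have [L hL] := admB_bounded P hP.
exact: (cost_unif_lip P hP zbar _ _ _ _ hK hL).
Qed.

Lemma G_fin_num u : admA P !=set0 -> UU P u -> G P zbar u \is a fin_num.
Proof.
move=> [alpha Aa] Uu; have [K [K0 hK]] := cost_lip.
have Bu i : admB P (row i u.2) by have [] := Uu i.
have upper : (G P zbar u <= K%:E)%E.
  apply: (G_le _ _ _ Uu Aa) => i; have [cK _] := hK _ _ _ Aa (Bu i) (Bu i).
  exact: le_trans (ler_norm _) cK.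
have lower : ((- K)%:E <= G P zbar u)%E.
  apply: G_ge => // s a Aa' /(_ ord0); apply: le_trans.
  have [+ _] := hK _ _ _ Aa' (Bu ord0) (Bu ord0).
  by rewrite ler_norml => /andP[].
by rewrite fin_numElt (lt_le_trans (ltNyr _) lower) (le_lt_trans upper (ltry _)).
Qed.

Lemma ler_norm_row {m n : nat} (M : 'M[R]_(m, n)) i : `|row i M| <= `|M|.
Proof. by apply: mx_norm_ler => // k j; rewrite mxE; exact: ler_mx_norm_entry. Qed.

(** If [(s, alpha)] is feasible for [u'], then [(s + K * delta, alpha)] is feasible
    for [u], where [delta] is the distance of the disturbance parameters. *)
Lemma G_lip : admA P !=set0 -> exists K, 0 <= K /\ forall u u', UU P u -> UU P u' ->
  `|fine (G P zbar u) - fine (G P zbar u')| <= K * `|u.2 - u'.2|.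
Proof.
move=> A0; have [K [K0 hK]] := cost_lip; exists K; split=> //.
have half u u' : UU P u -> UU P u' ->
    fine (G P zbar u) - K * `|u.2 - u'.2| <= fine (G P zbar u').
  move=> Uu Uu'; rewrite -lee_fin [leRHS]fineK; last exact: G_fin_num.
  apply: G_ge => // s a Aa ca; rewrite lerBlDr -lee_fin fineK; last exact: G_fin_num.
  apply: (G_le _ _ _ Uu Aa) => i; have [_ Bi] := Uu i; have [_ Bi'] := Uu' i.
  have [_ /(le_trans (ler_norm _)) ci] := hK _ _ _ Aa Bi Bi'.
  have := ler_wpM2l K0 (ler_norm_row (u.2 - u'.2) i); rewrite linearB /= => ri.
  have := ca i; lra.
move=> u u' Uu Uu'; rewrite ler_norml; apply/andP; split.
  by have := half _ _ Uu' Uu; rewrite distrC; lra.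
by have := half _ _ Uu Uu'; lra.
Qed.

(** The relaxation does not see the sampling times, so the maximization runs over
    the disturbance parameters alone, stacked into one row vector. *)
Lemma G_indep_time u u' : UU P u -> UU P u' -> u.2 = u'.2 ->
  G P zbar u = G P zbar u'.
Proof.
move=> Uu Uu' e; congr (ereal_inf (image _ _)); apply/seteqP.
by split=> -[s a] /relax_feasibleE H; apply/relax_feasibleE => //; move: H; rewrite e; exact.
Qed.

Lemma exists_max : admA P !=set0 -> admB P !=set0 -> exists u, solves_max P zbar u.
Proof.
move=> A0 [b0 Bb0]; have [K [K0 hK]] := G_lip A0.
pose n := ((Nv P).+1 * Nw P)%N.
pose emb (v : 'rV[R]_n) : U := (0, vec_mx v).
pose D := [set v : 'rV[R]_n | forall i, admB P (row i (vec_mx v))].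
have T0 := T_gt0 P hP.
have UUD v : D v -> UU P (emb v).
  by move=> Dv i; split; [rewrite mxE in_itv /= lexx ltW|exact: Dv].
have norm_vec (v : 'rV[R]_n) : `|vec_mx v : 'M[R]_((Nv P).+1, Nw P)| <= `|v|.
  by apply: mx_norm_ler => // i j; rewrite mxE; exact: ler_mx_norm_entry.
have D0 : D !=set0.
  exists (mxvec (\matrix_(i, j) b0 0 j)) => i; rewrite mxvecK.
  by rewrite (_ : row _ _ = b0) //; apply/rowP => j; rewrite !mxE.
have Dclosed : closed D.
  rewrite (_ : D = \bigcap_i [set v : 'rV[R]_n | admB P (row i (vec_mx v))]); last first.
    by apply/seteqP; split=> [v Dv i _|v Dv i]; exact: Dv.
  apply: closed_bigI => i _; move: (admB_closed P hP).
  apply: (proj1 (continuous_closedP (fun v : 'rV[R]_n => row i (vec_mx v)))).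
  apply/continuous_subspace_setT.
  apply: (lipschitz_within_continuous _ _ 1) => // v w _ _.
  rewrite -linearB -linearB /= mul1r.
  exact: le_trans (ler_norm_row _ _) (norm_vec _).
have Dcompact : compact D.
  apply: bounded_closed_compact => //.
  have [L hL] := admB_bounded P hP; exists L; split; first exact: num_real.
  move=> M LM v Dv; apply: mx_norm_ler => [|i j].
    have := hL _ Bb0; apply: contraTT; rewrite -!ltNge => M0.
    by rewrite (lt_le_trans (lt_trans LM M0)).
  rewrite (ord1 i); case/mxvec_indexP: j => k l.
  rewrite -[v]vec_mxK mxvecE; apply: le_trans (le_trans (hL _ (Dv k)) (ltW LM)).
  by have := ler_mx_norm_entry (row k (vec_mx v)) 0 l; rewrite mxE.
have fcont : {within D, continuous (fun v => fine (G P zbar (emb v)))}.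
  apply: (lipschitz_within_continuous _ _ K) => // v w Dv Dw.
  apply: le_trans (hK _ _ (UUD _ Dv) (UUD _ Dw)) _.
  by rewrite /= -linearB /= ler_wpM2l.
have [v /set_mem Dv vmax] := compact_EVT_max D0 Dcompact fcont.
exists (emb v); split; first exact: UUD.
apply/eqP; rewrite eq_le; apply/andP; split.
  by apply: ereal_sup_ubound; exists (emb v) => //; exact: UUD.
apply/ereal_supP => _ [u Uu <-].
have Du : D (mxvec u.2) by move=> i; rewrite mxvecK; have [] := Uu i.
rewrite (G_indep_time u (emb (mxvec u.2))) //; last 2 first.
- exact: UUD.
- by rewrite /= mxvecK.
rewrite -[leLHS]fineK ?G_fin_num //; last exact: UUD.
rewrite -[leRHS]fineK ?G_fin_num //; last exact: UUD.
by rewrite lee_fin; apply: vmax; exact/mem_set.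
Qed.

(** Helly's theorem lifts a level reached on all samples of [Nv + 1]
    disturbances to all disturbances at once: in dimension [Nv] this is the
    number of sets that has to be tested. *)
Lemma uniform_level (r : R) : admA P !=set0 -> admB P !=set0 ->
  (forall u, UU P u -> exists2 alpha, admA P alpha &
     forall i, cost P zbar alpha (row i u.2) <= r) ->
  exists2 alpha, admA P alpha & forall beta, admB P beta ->
    cost P zbar alpha beta <= r.
Proof.
move=> A0 [b0 Bb0] h.
pose C (b : 'rV[R]_(Nw P)) := [set a | admB P b -> cost P zbar a b <= r].
have [|b|b|g|a Aa Ca] := helly_compact (admA P) C (admA_compact P hP) _ A0.
- exact: admA_convex.
- have [Bb|nBb] := pselect (admB P b); last first.
    by rewrite (_ : C b = setT); [exact: closedT|apply/seteqP; split=> // a _ /nBb].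
  rewrite (_ : C b = [set a | cost P zbar a b <= r]); last first.
    by apply/seteqP; split=> [a /(_ Bb)//|a ca _].
  by apply: closed_sublevel; exact: cost_continuous.
- move=> x y t Cx Cy t01 Bb.
  by apply: (convexs_sublevel _ _ (cost_convex P hP zbar b)) => //; [exact: Cx|exact: Cy].
- (* An inadmissible index imposes no constraint, so it may be replaced by [b0]. *)
  pose g' i := if `[< admB P (g i) >] then g i else b0.
  have Bg' i : admB P (g' i) by rewrite /g'; case: asboolP.
  have rg i : row i (\matrix_k g' k) = g' i by rewrite rowK.
  have [|a Aa ca] := h (0, \matrix_k g' k).
    by move=> i; rewrite /= rg mxE in_itv /= lexx ltW //; exact: T_gt0 P hP.
  exists a => // k Bg; have := ca k; rewrite /= rg /g'.
  by case: asboolP.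
- by exists a => // b; exact: Ca.
Qed.

(** The slack [e] replaces attainment of the infimum defining [G]: the level
    [G u + e] is reached on every sample because [u] is a maximizer. *)
Lemma Vstar_eq u : admB P !=set0 -> ZF P zbar -> solves_max P zbar u ->
  Vstar P zbar = G P zbar u.
Proof.
move=> B0 [[s0 a0] [/= Aa0 _]] [Uu umax].
have A0 : admA P !=set0 by exists a0.
have fG := G_fin_num u A0 Uu.
apply/eqP; rewrite eq_le; apply/andP; split; last first.
  apply: ereal_inf_le_tmp => _ [[s a] [/= Aa h] <-]; exists (s, a) => //.
  by apply/relax_feasibleE => //; split=> // i; have [tT Bi] := Uu i; have [] := h _ _ tT Bi.
apply/lee_addgt0Pr => e e0; rewrite -[G P zbar u]fineK // -EFinD.
have [|a Aa ca] := uniform_level (fine (G P zbar u) + e) A0 B0.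
  move=> u' Uu'; apply: G_lt => //; rewrite EFinD fineK //.
  apply: (@le_lt_trans _ _ (G P zbar u)); last by rewrite lteDl.
  by rewrite umax; apply: ereal_sup_ubound; exists u'.
apply: ereal_inf_lbound; exists (fine (G P zbar u) + e, a) => //; split=> // t b tT Bb /=.
have [a0' _ aV] := Aa; have [b0 _ _] := Bb.
by split; [exact: ca| |rewrite a0'|exact: aV].
Qed.

End relaxation.

Theorem mainTheorem1 (R : realType) (P : sip_data R) (hP : standing P)
    (hB : admB P !=set0) (hZ : ZF P !=set0)
    (VV' : set R) (hVV' : VV' `<=` (VV P)°)
    (zbar : 'cV[R]_(zdim P)) (hzbar : ZF P zbar) (hslater : slater P VV' zbar) :
  [/\ (* (a) G is real-valued and Lipschitz continuous on UU *)
      (forall u, UU P u -> G P zbar u \is a fin_num)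
        /\ [lipschitz fine (G P zbar u) | u in UU P],
      (* (b) *)
      exists u, solves_max P zbar u
    & (* (c) for every maximizer *)
      forall u, solves_max P zbar u -> Vstar P zbar = G P zbar u].
Proof.
have A0 : admA P !=set0 by have [[s a] [Aa _]] := hzbar; exists a.
split; last by move=> u; exact: Vstar_eq.
- split=> [u|]; first exact: G_fin_num.
  have [u0 [Uu0 _]] := exists_max P hP zbar A0 hB.
  have [K [K0 hK]] := G_lip P hP zbar A0.
  have pF : ProperFilter (globally (UU P `*` UU P)).
    exact: (globally_properfilter (a := (u0, u0))).
  apply: (@klipschitzW _ _ _ K) => -[u u'] /= [Uu Uu'].
  apply: le_trans (hK _ _ Uu Uu') _; rewrite ler_wpM2l //.
  by rewrite [leRHS]prod_normE le_max lexx orbT.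
- exact: exists_max.
Qed.
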